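(* $F_e(J_4,J_4;5)\le 51$; that is, there exists a $K_5$-free graph $G$ on 51 vertices such that every red-blue coloring of $E(G)$ contains a monochromatic copy of $J_4$.
   Context: All graphs are finite and simple. $J_4$ denotes $K_4$ with one edge removed. $G\rightarrow(H_1,H_2)^e$ means: for every coloring of $E(G)$ with colors 1, 2 there is $i$ such that the subgraph formed by the edges of color $i$ contains a (not necessarily induced) copy of $H_i$. The edge Folkman number $F_e(H_1,H_2;k)$ is the minimum number of vertices of a $K_k$-free graph $G$ with $G\rightarrow(H_1,H_2)^e$. *)

(* Defs.v *)
From mathcomp Require Import all_boot.
Set Implicit Arguments. Unset Strict Implicit. Unset Printing Implicit Defensive.

Definition simple_graph (V : finType) (g : rel V) : Prop :=
  irreflexive g /\ symmetric g.

Definition contains_copy (W V : finType) (h : rel W) (g : rel V) : Prop :=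
  exists f : W -> V, injective f /\ forall x y, h x y -> g (f x) (f y).

Definition complete_graph (n : nat) : rel 'I_n := fun i j => i != j.
Arguments complete_graph n : clear implicits.

(* J_4 = K_4 minus the edge {0,1}, on 'I_4. *)
Definition J4 : rel 'I_4 :=
  fun i j => (i != j) && ~~ ((val i <= 1) && (val j <= 1)).

(* G -> (H1,H2)^e : for every 2-coloring of E(G) (a symmetric function
   c : V -> V -> bool; colour 1 = true, colour 2 = false; only values on
   edges matter), the colour-1 subgraph contains H1 or the colour-2
   subgraph contains H2. *)
Definition arrows_e (V W1 W2 : finType) (g : rel V) (h1 : rel W1) (h2 : rel W2)
  : Prop :=
  forall c : V -> V -> bool, (forall x y, c x y = c y x) ->
    contains_copy h1 (fun x y => g x y && c x y) \/
    contains_copy h2 (fun x y => g x y && ~~ c x y).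

(* Main.v *)
(** The graph is a cone [u] over a blow-up of a [K_4]-free graph [H] on 14
    vertices: eight vertices of [H] become independent sets (blobs) of size 4
    and six become blobs of size 3, which gives [8 * 4 + 6 * 3 + 1 = 51].
    In a colouring without monochromatic [J_4], look at the vertices joined to
    [u] in red.  The red edges among them form a matching, and this forces every
    triangle of blobs with two red vertices each to be perfectly matched in red.
    Hence two such triangles never share a blob, and no blob of such a triangle
    has a third red vertex; the same holds for blue.  So each blob is "at least
    twice red" or "at least twice blue", and a blob of size 4 in a red triangle
    is both.  A finite search shows that [H] admits no such labelling. *)

Require Import Defs.
From mathcomp Require Import all_boot.

Set Implicit Arguments. Unset Strict Implicit. Unset Printing Implicit Defensive.

(** * Cliques by an evaluable search *)

Section Cliques.
Variable e : rel nat.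

Fixpoint has_clique (k : nat) (s : seq nat) : bool :=
  if k is k'.+1 then has (fun v => has_clique k' [seq w <- s | e v w]) s
  else true.

Lemma pairwise_has_clique (l s : seq nat) :
  {subset l <= s} -> pairwise e l -> has_clique (size l) s.
Proof.
elim: l s => [//|v l IHl] s sub_l /= /andP[ev_l pair_l].
apply/hasP; exists v; first by rewrite sub_l ?mem_head.
apply: IHl => // w w_l; rewrite mem_filter (allP ev_l _ w_l) /=.
by rewrite sub_l // in_cons w_l orbT.
Qed.

End Cliques.

(** * [J4] as two triangles on a common edge *)

Section MonochromaticJ4.
Variables (V : finType) (e : rel V).

(** The common edge is [p q], the tips are [x] and [y]; nothing is asked of [e x y], since copies
    need not be induced. *)
Definition has_J4 : bool :=
  [exists x, exists y, exists p, exists q,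
    [&& x != y, e p q, e p x, e p y, e q x & e q y]].

Hypotheses (eirr : irreflexive e) (esym : symmetric e).

Lemma has_J4_copy : has_J4 -> contains_copy J4 e.
Proof.
case/existsP=> x /existsP[y /existsP[p /existsP[q]]].
case/and5P=> xy pq px py /andP[qx qy].
have neq (a b : V) : e a b -> (a == b) = false.
  by apply: contraTF => /eqP->; rewrite eirr.
exists (fun i : 'I_4 => nth x [:: x; y; p; q] i); split.
  move=> i j /eqP; rewrite nth_uniq ?(valP i) ?(valP j) //; first by move/eqP/val_inj.
  rewrite /= !inE !negb_or xy (neq _ _ pq) !(eq_sym x) !(eq_sym y).
  by rewrite (neq _ _ px) (neq _ _ py) (neq _ _ qx) (neq _ _ qy).
case=> [[|[|[|[|//]]]] ?] [[|[|[|[|//]]]] ?] //=; by rewrite // esym.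
Qed.

End MonochromaticJ4.

(** * Red edges inside the red neighbourhood [S] of a vertex *)

Section Matching.
Variables (V : finType) (S : pred V) (g red blue : rel V).
Hypotheses (gsym : symmetric g) (girr : irreflexive g).
Hypotheses (rsym : symmetric red) (bsym : symmetric blue).
Hypothesis colored : forall x y, g x y -> red x y || blue x y.
Hypothesis red_matching : forall a x y,
  S a -> S x -> S y -> red a x -> red a y -> x = y.
Hypothesis blue_J4free : forall p q x y,
  blue p q -> blue p x -> blue p y -> blue q x -> blue q y -> x = y.

Definition twin (p : V * V) : bool := [&& S p.1, S p.2 & p.1 != p.2].
Definition joined (p q : V * V) : bool :=
  [&& g p.1 q.1, g p.1 q.2, g p.2 q.1 & g p.2 q.2].

Lemma joined_sym : symmetric joined.
Proof. by case=> x x' [y y']; rewrite /joined /= !(gsym y) !(gsym y'); congr (_ && _); rewrite andbCA. Qed.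

Lemma twin_swap p : twin (p.2, p.1) = twin p.
Proof. by rewrite /twin /= eq_sym andbCA. Qed.

Lemma joined_swap p q : joined (p.2, p.1) q = joined p q.
Proof. by rewrite /joined /= andbA andbC -andbA. Qed.

(** If [p.1] were blue to all four vertices, the red edges between [q] and [r] would have to be a
    perfect matching, and then a blue [J4] with tips [p.1], [p.2] appears. *)
Lemma twin_matched p q r : twin p -> twin q -> twin r ->
  joined p q -> joined p r -> joined q r ->
  has (red p.1) [:: q.1; q.2; r.1; r.2].
Proof.
case: p q r => [a a'] [x x'] [y y']; rewrite /twin /joined /=.
move=> /and3P[Sa Sa' aa'] /and3P[Sx Sx' xx'] /and3P[Sy Sy' yy'].
move=> /and4P[gax gax' ga'x ga'x'] /and4P[gay gay' ga'y ga'y'].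
move=> /and4P[gxy gxy' gx'y gx'y'] /=.
apply: contraT; rewrite orbF !negb_or => /and4P[nx nx' ny ny'].
have bl z : ~~ red a z -> g a z -> blue a z.
  by move=> /negPf nrz /colored; rewrite nrz.
have {nx nx' ny ny'} [bax bax' bay bay'] :
    [/\ blue a x, blue a x', blue a y & blue a y'] by split; apply: bl.
(* Otherwise [a z] is the common edge of a blue [J4] with tips [y], [y']. *)
have redy z : blue a z -> g z y -> g z y' -> red z y || red z y'.
  move=> baz /colored; case: (red z y) => //= bzy /colored /orP[->//|bzy'].
  by rewrite (blue_J4free baz bay bay') ?eqxx // in yy'.
(* Here [x] and [w'] have the red partners [w] and [x'], so [x w'], [a' x] and [a' w'] are blue. *)
have cross w w' : S w -> S w' -> w != w' -> blue a w' -> g a' w -> g a' w' ->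
    g x w' -> red x w -> red x' w' -> False.
  move=> Sw Sw' ww' baw' ga'w ga'w' gxw' rxw rx'w'.
  have ba'x : blue a' x.
    case/orP: (colored ga'x) => // ra'x; rewrite rsym in ra'x.
    by rewrite (red_matching Sx Sa' Sw) ?girr in ga'w.
  have ba'w' : blue a' w'.
    case/orP: (colored ga'w') => // ra'w'; rewrite rsym in ra'w'.
    rewrite rsym in rx'w'.
    by rewrite (red_matching Sw' Sa' Sx') ?girr in ga'x'.
  have bxw' : blue x w'.
    case/orP: (colored gxw') => // rxw'.
    by rewrite (red_matching Sx Sw Sw') ?eqxx in ww'.
  by move: aa'; rewrite (@blue_J4free x w' a a') ?eqxx // bsym.
have notboth w : S w -> red x w -> red x' w -> False.
  move=> Sw; rewrite !(rsym _ w) => rwx rwx'.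
  by rewrite (red_matching Sw Sx Sx') ?eqxx in xx'.
exfalso; case/orP: (redy x bax gxy gxy') => rx.
- case/orP: (redy x' bax' gx'y gx'y') => rx'; first exact: (notboth y).
  exact: (cross y y').
- case/orP: (redy x' bax' gx'y gx'y') => rx'; last exact: (notboth y').
  by apply: (cross y' y) => //; rewrite eq_sym.
Qed.

(* The partner of [s.1] in [p] or [q] also has a partner in [p], [q], [r]. *)
Lemma twin_no_extra p q r s : twin p -> twin q -> twin r -> twin s ->
  joined p q -> joined p r -> joined q r -> joined p s -> joined q s ->
  s.1 != r.1 -> s.1 != r.2 -> False.
Proof.
move=> Tp Tq Tr Ts pq pr qr ps qs sr1 sr2.
have [qp sp sq] : [/\ joined q p, joined s p & joined s q].
  by split; rewrite joined_sym.
(* The partner of [a] in [t] or [r] would be [s.1], which is adjacent to both vertices of [t] and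
   lies outside [r]. *)
have unmatched a x t : twin (a, x) -> twin t -> joined (a, x) t ->
    joined (a, x) r -> joined t r -> joined t s -> ~~ red s.1 a.
  move=> Ta Tt at_ ar tr ts; apply/negP; rewrite rsym => ras.
  have /= := twin_matched Ta Tt Tr at_ ar tr; rewrite orbF.
  have [/= Sa _ _] := and3P Ta; have [St1 St2 _] := and3P Tt.
  have [Sr1 Sr2 _] := and3P Tr; have [Ss _ _] := and3P Ts.
  have [gts1 _ gts2 _] := and4P ts.
  case/or4P=> ra; have es := red_matching Sa Ss _ ras ra.
  - by rewrite es ?girr in gts1.
  - by rewrite es ?girr in gts2.
  - by rewrite es ?eqxx in sr1.
  - by rewrite es ?eqxx in sr2.
have := twin_matched Ts Tp Tq sp sq pq; rewrite /= orbF.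
rewrite (negPf (unmatched p.1 p.2 q _ _ _ _ _ _)) -?surjective_pairing //=.
rewrite (negPf (unmatched q.1 q.2 p _ _ _ _ _ _)) -?surjective_pairing //=.
rewrite (negPf (unmatched p.2 p.1 q _ _ _ _ _ _)) ?twin_swap ?joined_swap //=.
by rewrite (negPf (unmatched q.2 q.1 p _ _ _ _ _ _)) ?twin_swap ?joined_swap.
Qed.

(** * Triangles of blobs in a blow-up of [Q] *)

Variables (blob : V -> nat) (Q : rel nat).
Hypothesis gQ : forall x y, g x y = Q (blob x) (blob y).

Definition weight (i : nat) : nat := #|[pred x | (blob x == i) && S x]|.

Definition twin_in (i : nat) (p : V * V) : bool :=
  [&& twin p, blob p.1 == i & blob p.2 == i].

Lemma weight_twin i : 1 < weight i -> exists p, twin_in i p.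
Proof.
case/card_gt1P=> x [y [/andP[/= xi Sx] /andP[/= yi Sy] xy]].
by exists (x, y); rewrite /twin_in /twin /= Sx Sy xy xi yi.
Qed.

Lemma twin_in_twin i p : twin_in i p -> twin p.
Proof. by case/and3P. Qed.

Lemma twin_in_joined i j p q :
  Q i j -> twin_in i p -> twin_in j q -> joined p q.
Proof.
move=> Qij /and3P[_ /eqP p1 /eqP p2] /and3P[_ /eqP q1 /eqP q2].
by rewrite /joined !gQ p1 p2 q1 q2 Qij.
Qed.

Definition rich_triangle (i j k : nat) : bool :=
  [&& Q i j, Q i k & Q j k] && [&& 1 < weight i, 1 < weight j & 1 < weight k].

(** A third vertex [z] gives the twin [(z, x)] beside [(x, y)]; their overlap is harmless, as
    [twin_no_extra] only needs [z] outside [(x, y)]. *)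
Lemma rich_triangle_weight i j k : rich_triangle i j k -> weight i <= 2.
Proof.
case/andP=> /and3P[Qij Qik Qjk] /and3P[_ /weight_twin[p pj] /weight_twin[q qk]].
rewrite leqNgt; apply/negP => /card_gt2P[x [y [z []]]].
move=> [/andP[/= xi Sx] /andP[/= yi Sy] /andP[/= zi Sz]] [xy yz zx].
have xyi : twin_in i (x, y) by rewrite /twin_in /twin /= Sx Sy xy xi yi.
have zxi : twin_in i (z, x) by rewrite /twin_in /twin /= Sz Sx zx zi xi.
apply: (@twin_no_extra p q (x, y) (z, x));
  rewrite ?(twin_in_twin pj) ?(twin_in_twin qk) ?(twin_in_twin xyi)
    ?(twin_in_twin zxi) // ?[joined _ (_, _)]joined_sym.
- exact: twin_in_joined Qjk pj qk.
- exact: twin_in_joined Qij xyi pj.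
- exact: twin_in_joined Qik xyi qk.
- exact: twin_in_joined Qij zxi pj.
- exact: twin_in_joined Qik zxi qk.
- by rewrite eq_sym.
Qed.

Lemma rich_triangle_edge i j k l :
  rich_triangle i j k -> rich_triangle i j l -> k = l.
Proof.
case/andP=> /and3P[Qij Qik Qjk].
case/and3P=> /weight_twin[p pi] /weight_twin[q qj] /weight_twin[r rk].
case/andP=> /and3P[_ Qil Qjl] /and3P[_ _ /weight_twin[s sl]].
apply/eqP; apply: contraT => kl; exfalso.
have [[_ /eqP r1 /eqP r2] [_ /eqP s1 _]] := (and3P rk, and3P sl).
have neq x : blob x = k -> s.1 != x.
  by move=> xk; apply: contraNneq kl => sx; rewrite -xk -s1 sx.
apply: (@twin_no_extra p q r s); rewrite ?neq ?(twin_in_twin pi)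
  ?(twin_in_twin qj) ?(twin_in_twin rk) ?(twin_in_twin sl) //.
- exact: twin_in_joined Qij pi qj.
- exact: twin_in_joined Qik pi rk.
- exact: twin_in_joined Qjk qj rk.
- exact: twin_in_joined Qil pi sl.
- exact: twin_in_joined Qjl qj sl.
Qed.

(** A vertex of [S] in blob [i] has a red partner in each triangle; the matching makes the two
    equal, so their blob is common. *)
Lemma rich_triangle_vertex i j k l m :
  rich_triangle i j k -> rich_triangle i l m ->
  (j == l) || (j == m) || (k == l) || (k == m).
Proof.
case/andP=> /and3P[Qij Qik Qjk].
case/and3P=> /weight_twin[p pi] /weight_twin[q qj] /weight_twin[r rk].
case/andP=> /and3P[Qil Qim Qlm] /and3P[_ /weight_twin[s sl] /weight_twin[t tm]].
have red_in x y i' j' : twin_in i' x -> twin_in j' y -> Q i j -> Q i i' ->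
    Q i j' -> Q i' j' ->
    exists z, [&& S z, red p.1 z & (blob z == i') || (blob z == j')].
  move=> xi yj _ Qii Qij' Qij''.
  have := twin_matched (twin_in_twin pi) (twin_in_twin xi) (twin_in_twin yj)
    (twin_in_joined Qii pi xi) (twin_in_joined Qij' pi yj)
    (twin_in_joined Qij'' xi yj).
  case/and3P: xi => /and3P[Sx1 Sx2 _] bx1 bx2.
  case/and3P: yj => /and3P[Sy1 Sy2 _] by1 by2.
  case/hasP=> z; rewrite !inE => /or4P[] /eqP-> rz; eexists; apply/and3P;
    by split; [|exact: rz|]; rewrite ?bx1 ?bx2 ?by1 ?by2 ?orbT.
have [z /and3P[Sz rz bz]] := red_in q r j k qj rk Qij Qij Qik Qjk.
have [w /and3P[Sw rw bw]] := red_in s t l m sl tm Qij Qil Qim Qlm.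
have /and3P[/and3P[Sp _ _] _ _] := pi.
move: bz bw; rewrite (red_matching Sp Sz Sw rz rw).
by case/orP=> /eqP-> /orP[] ->; rewrite ?orbT.
Qed.

Lemma rich_triangle_sym i j k : rich_triangle i j k -> rich_triangle i k j.
Proof.
have gQsym x y : Q (blob x) (blob y) = Q (blob y) (blob x) by rewrite -!gQ gsym.
case/andP=> /and3P[Qij Qik Qjk] /and3P[wi wj wk]; apply/andP; split; last first.
  by rewrite wi wj wk.
have [p /and3P[_ /eqP pj _]] := weight_twin wj.
have [q /and3P[_ /eqP qk _]] := weight_twin wk.
by rewrite Qij Qik -pj -qk gQsym pj qk.
Qed.

(** A shared blob forces a shared edge, and a shared edge forces equality. *)
Lemma rich_triangle_inj i j k l m : j < k -> l < m ->
  rich_triangle i j k -> rich_triangle i l m -> (j, k) = (l, m).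
Proof.
move=> jk lm ijk ilm; have [ikj iml] := (rich_triangle_sym ijk, rich_triangle_sym ilm).
have := rich_triangle_vertex ijk ilm; rewrite -!orbA.
case/or4P=> /eqP e; subst.
- by rewrite (rich_triangle_edge ijk ilm).
- by rewrite (rich_triangle_edge ijk iml) ltnNge (ltnW lm) in jk.
- by rewrite -(rich_triangle_edge ikj ilm) ltnNge (ltnW jk) in lm.
- by rewrite (rich_triangle_edge ikj iml).
Qed.

End Matching.

(** * Exhaustive search over labellings of the blobs *)

Section Labelling.
Variables (triangles : seq (nat * nat * nat)) (big : pred nat).

(** Nested [if]s let call-by-value evaluation stop at the first [false]. *)
Definition full (r : pred nat) (T : nat * nat * nat) : bool :=
  if r T.1.1 then if r T.1.2 then r T.2 else false else false.

Definition consistent (r t : pred nat) : bool :=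
  let full_r := [seq T <- triangles | full r T] in
  all (fun T => (big T.1.1 ==> t T.1.1) &&
                all (fun T' => (T.1.1 == T'.1.1) ==> (T == T')) full_r) full_r.

(* [r] and [t] are prefixes of two labellings; positions not yet decided read as
   [false] and cannot cause an inconsistency. *)
Fixpoint refute (n : nat) (r t : seq bool) : bool :=
  if consistent (nth false r) (nth false t) then
    if consistent (nth false t) (nth false r) then
      if n is n'.+1 then
        if refute n' (rcons r true) (rcons t false) then
          if refute n' (rcons r false) (rcons t true) then
            refute n' (rcons r true) (rcons t true)
          else false
        else false
      else false
    else true
  else true.

Lemma fullE r T : full r T = [&& r T.1.1, r T.1.2 & r T.2].
Proof. by rewrite /full; case: (r _) => //; case: (r _). Qed.

(** Truncation creates no full triangle, and the first vertex of one that stays full is below [m],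
    where [t] is kept. *)
Lemma consistent_mkseq (r t : pred nat) m : consistent r t ->
  consistent (nth false (mkseq r m)) (nth false (mkseq t m)).
Proof.
have nthE (f : pred nat) i : nth false (mkseq f m) i = (i < m) && f i.
  by case: ltnP => im; [rewrite nth_mkseq | rewrite nth_default ?size_mkseq].
have full_sub T : full (nth false (mkseq r m)) T ->
    (T.1.1 < m) && full r T.
  by rewrite !fullE !nthE => /and3P[/andP[-> ->] /andP[_ ->] /andP[_ ->]].
move=> /allP cons; apply/allP => T.
rewrite mem_filter => /andP[/full_sub/andP[Tm rT] T_in].
have /cons/andP[bigT /allP uniqT] : T \in [seq T <- triangles | full r T].
  by rewrite mem_filter rT.
rewrite nthE Tm bigT; apply/allP => T'; rewrite mem_filter.
case/andP=> /full_sub/andP[_ rT'] T'_in; apply: uniqT.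
by rewrite mem_filter rT'.
Qed.

(** The prefixes of an actual labelling form a branch that is never pruned; the covering hypothesis
    rules out the label pair with both [false], which the search omits. *)
Lemma refuteP (r t : pred nat) n m :
  consistent r t -> consistent t r -> (forall i, i < m + n -> r i || t i) ->
  refute n (mkseq r m) (mkseq t m) = false.
Proof.
move=> rt tr; elim: n m => [|n IHn] m cover /=; rewrite !consistent_mkseq //.
have := IHn m.+1; rewrite addSnnS => /(_ cover).
have := cover m; rewrite addnS ltnS leq_addr => /(_ isT).
rewrite /mkseq -addn1 !iotaD !map_cat !cats1 /=.
by case: (r m) (t m) => [] [] // _ ->; rewrite /= ?if_same.
Qed.

End Labelling.

(** * The graph [H], its cone and the blow-up *)

(* Neighbours of larger index; [H] was found by a randomised computer search. *)
Definition H_up : seq (seq nat) :=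
  [:: [:: 1; 5; 6; 10; 12; 13];
      [:: 3; 4; 7; 10; 11; 12; 13];
      [:: 3; 4; 5; 6; 7; 9; 10; 13];
      [:: 4; 8; 13];
      [:: 6; 9; 10; 11; 12];
      [:: 8; 9; 10; 11; 12; 13];
      [:: 8; 11; 12; 13];
      [:: 8; 9; 10; 12; 13];
      [:: 10; 11; 12];
      [:: 11; 12];
      [::];
      [:: 13]].

(** Vertices 12 and 13 have no row in [H_up] and get the default [[::]]. *)
Definition cone_up (i j : nat) : bool :=
  if j == 14 then i < 14 else j \in nth [::] H_up i.

Definition cone_adj (i j : nat) : bool := cone_up i j || cone_up j i.

(** Each triangle occurs once for each choice of first vertex, because [consistent] constrains only
    that vertex. *)
Definition H_triangles : seq (nat * nat * nat) :=
  [seq (i, jk.1, jk.2) | i <- iota 0 14,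
     jk <- [seq (j, k) | j <- [seq j <- iota 0 14 | cone_adj i j],
       k <- [seq k <- iota 0 14 | (j < k) && cone_adj i k && cone_adj j k]]].

(* Blobs 0..7 have size 4 and blobs 8..13 size 3; the last vertex, 50, falls in
   blob 14, which is the cone. *)
Definition blob (x : 'I_51) : nat :=
  if x < 32 then x %/ 4 else 8 + (x - 32) %/ 3.

Lemma H_refute : refute H_triangles (fun i => i < 8) 14 [::] [::].
Proof. by vm_compute. Qed.

Lemma cone_no_K5 : has_clique cone_adj 5 (iota 0 15) = false.
Proof. by vm_compute. Qed.

Lemma cone_adj_sym : symmetric cone_adj.
Proof. by move=> i j; rewrite /cone_adj orbC. Qed.

Lemma blob_lt15 x : blob x < 15.
Proof.
rewrite /blob; case: (ltnP x 32) => x32; first by apply: (@leq_trans 8); rewrite ?ltn_divLR.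
by rewrite (@ltn_add2l 8 _ 7) ltn_divLR // ltn_subLR // (leq_trans (ltn_ord x)).
Qed.

Lemma cone_adj_blob_irr : irreflexive (fun x y => cone_adj (blob x) (blob y)).
Proof.
move=> x; apply: negbTE.
have /allP : all (fun i => ~~ cone_adj i i) (iota 0 15) by [].
by apply; rewrite mem_iota blob_lt15.
Qed.

Lemma card_blob i : i < 14 -> #|[pred x | blob x == i]| = 3 + (i < 8).
Proof.
pose f x := nat_of_bool ((if x < 32 then x %/ 4 else 8 + (x - 32) %/ 3) == i).
have ->: #|[pred x | blob x == i]| = \sum_(0 <= x < 51) f x.
  by rewrite big_mkord -sum1_card big_mkcond.
by rewrite unlock {}/f; move: i; do 14?[case=> [//|]].
Qed.

(** * Every colouring of the blow-up has a monochromatic [J4] *)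

Theorem theorem10 :
  exists g : rel 'I_51,
    simple_graph g /\
    ~ contains_copy (complete_graph 5) g /\
    arrows_e g J4 J4.
Proof.
pose g := [rel x y | cone_adj (blob x) (blob y)].
have gsym : symmetric g by move=> x y; apply: cone_adj_sym.
have girr : irreflexive g := cone_adj_blob_irr.
exists g; split=> //; split.
  case=> f [_ f_clique].
  have /(@pairwise_has_clique _ _ (iota 0 15)) :
      pairwise cone_adj [seq blob (f i) | i <- enum 'I_5].
    rewrite pairwise_map; apply: sub_pairwise (_ : pairwise [rel i j | i != j] _).
      by move=> i j ij; apply: f_clique.
    by rewrite -uniq_pairwise enum_uniq.
  rewrite size_map size_enum_ord cone_no_K5 => /(_ _) absurd.
  by apply/notF/absurd => _ /mapP[i _ ->]; rewrite mem_iota blob_lt15.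
move=> c csym.
pose col b := [rel x y | g x y && (c x y == b)].
have colsym b : symmetric (col b) by move=> x y; rewrite /= cone_adj_sym csym.
have colirr b : irreflexive (col b) by move=> x; rewrite /= [cone_adj _ _]girr.
have [/(has_J4_copy (colirr _) (colsym _)) copy|noJ4t] := boolP (has_J4 (col true)).
  left; have [h [h_inj h_edge]] := copy; exists h; split=> // x y /h_edge.
  by rewrite /= eqb_id.
have [/(has_J4_copy (colirr _) (colsym _)) copy|noJ4f] := boolP (has_J4 (col false)).
  right; have [h [h_inj h_edge]] := copy; exists h; split=> // x y /h_edge.
  by rewrite /= eqbF_neg.
exfalso.
have J4free b p q x y : col b p q -> col b p x -> col b p y ->
    col b q x -> col b q y -> x = y.
  move=> pq px py qx qy; apply/eqP; apply: contraT => xy.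
  have : has_J4 (col b).
    apply/existsP; exists x; apply/existsP; exists y.
    by apply/existsP; exists p; apply/existsP; exists q; apply/and5P; split=> //; apply/andP.
  by case: (b); apply: contraLR.
pose u : 'I_51 := ord_max.
have gu x : g u x = (blob x < 14).
  have u14 : blob u = 14 by [].
  rewrite /= u14 /cone_adj /cone_up eqxx; have := blob_lt15 x.
  by rewrite ltnS leq_eqVlt; case: eqP => [->|_ /= ->] //; rewrite orbT.
pose S b := [pred x | col b u x].
have colored b x y : g x y -> col b x y || col (~~ b) x y.
  by move=> /= ->; case: (c x y) (b) => [] [].
(* Two such edges at [a] give a [J4] on the common edge [u a]. *)
have matching b a x y : S b a -> S b x -> S b y -> col b a x -> col b a y -> x = y.
  by move=> Sa Sx Sy ax ay; apply: (J4free b u a).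
pose w b i := weight (S b) blob i.
have w_sum i : i < 14 -> w true i + w false i = 3 + (i < 8).
  move=> i14; rewrite -card_blob // -(cardID (c u)); congr (_ + _).
  - apply: eq_card => x; rewrite !inE -[cone_adj _ _]/(g u x) gu.
    by case: eqP => //= ->; rewrite i14 eqb_id.
  - apply: eq_card => x; rewrite !inE -[cone_adj _ _]/(g u x) gu.
    by case: eqP => [->|_]; rewrite ?andbF //= i14 eqbF_neg andbT.
have w_cover i : i < 14 -> (1 < w true i) || (1 < w false i).
  move/w_sum => w_eq; case: (leqP (w true i) 1) => //= wt.
  by case: leqP => // wf; have := leq_add wt wf; rewrite w_eq.
have consistent_w b : consistent H_triangles (fun i => i < 8)
    (fun i => 1 < w b i) (fun i => 1 < w (~~ b) i).
  have rich T : T \in [seq T <- H_triangles | full (fun i => 1 < w b i) T] ->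
      T.1.2 < T.2 /\ rich_triangle (S b) blob cone_adj T.1.1 T.1.2 T.2 /\ T.1.1 < 14.
    rewrite mem_filter fullE => /andP[wT].
    case/allpairsPdep=> i [jk [i_in /allpairsPdep[j [k [j_in k_in ->]]] eT]].
    move: wT; rewrite eT /=; move: i_in j_in k_in; rewrite !mem_filter !mem_iota.
    move=> /= i14 /andP[ij _] /andP[/andP[/andP[jk' ik] jk'' _]] wT.
    by rewrite /rich_triangle ij ik jk'' wT.
  have gE x y : g x y = cone_adj (blob x) (blob y) by [].
  apply/allP => T /rich[jk [Trich i14]]; apply/andP; split.
    apply/implyP => i8.
    have := rich_triangle_weight gsym girr (colsym b) (colsym (~~ b))
      (colored b) (matching b) (J4free (~~ b)) gE Trich.
    (* Of four vertices at most two have colour [b] to [u], so at least two have the other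
       colour. *)
    have w4 : w b T.1.1 + w (~~ b) T.1.1 = 4.
      by have := w_sum _ i14; rewrite i8; case: (b) => //; rewrite addnC.
    by rewrite -(ltn_add2l (w b T.1.1)) w4 addn1.
  apply/allP => T' /rich[jk' [Trich' _]]; apply/implyP => /eqP ii.
  rewrite -ii in Trich'.
  have := rich_triangle_inj gsym girr (colsym b) (colsym (~~ b)) (colored b)
    (matching b) (J4free (~~ b)) gE jk jk' Trich Trich'.
  by move: ii; case: (T) (T') => [[i j] k] [[i' j'] k'] /= -> [-> ->].
have := refuteP (n := 14) (m := 0) (consistent_w true) (consistent_w false) w_cover.
by rewrite H_refute.
Qed.
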